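(* Let $I=[a,b]$ be a compact interval, let $(X,d)$ be a complete metric space, let $g:I\to\mathbb R$ be left-continuous and nondecreasing, let $\alpha>1$, let $F:I\to\mathcal K(X)$ be $g$-Hölder of exponent $\alpha$, and let $p>1$. Then, for every $a\le s<t\le b$, $$\mathcal R^H_{p,g}(F;[s,t])=\sum_{\substack{\tau\in[s,t)\\ \Delta^+g(\tau)>0}}\frac{J_F(\tau)^p}{[\Delta^+g(\tau)]^{p-1}}.$$ The identity is valid for countably many jump points, including families with accumulation points.
   Context: $\mathcal K(X)$ is the family of all nonempty compact subsets of $X$ with Hausdorff distance $d_H$. $F$ is $g$-Hölder of exponent $\alpha$ if there is $L\ge0$ with $d_H(F(s),F(t))\le L|g(t)-g(s)|^\alpha$ for all $s,t\in I$. For $\tau\in[a,b)$: $\Delta^+g(\tau)=g(\tau+)-g(\tau)$ with $g(\tau+)=\lim_{r\downarrow\tau}g(r)$; $F(\tau+)=\lim_{r\downarrow\tau}F(r)$ in $(\mathcal K(X),d_H)$ (under the stated hypotheses this limit exists for every $\tau\in[a,b)$); $J_F(\tau)=d_H(F(\tau+),F(\tau))$. The Hausdorff Riesz $p$-variation of $F$ with respect to $g$ is $$\mathcal R^H_{p,g}(F;[s,t])=\sup_P\sum_{i=1}^n\frac{d_H(F(t_i),F(t_{i-1}))^p}{[g(t_i)-g(t_{i-1})]^{p-1}},$$ the supremum over all finite partitions $P:s=t_0<\cdots<t_n=t$; if $g(t_i)=g(t_{i-1})$, the corresponding term is $0$ when $F(t_i)=F(t_{i-1})$ and $+\infty$ otherwise.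 *)

(* Defs.v *)
From HB Require Import structures.
From mathcomp Require Import all_boot all_order all_algebra.
From mathcomp Require Import all_classical all_reals all_analysis.

Set Implicit Arguments.
Unset Strict Implicit.
Unset Printing Implicit Defensive.

Import Order.TTheory GRing.Theory Num.Theory.
Import numFieldNormedType.Exports.

Local Open Scope classical_set_scope.
Local Open Scope ring_scope.

(* Inherits a distinguished point from [completeType]: X is nonempty, which is
   no restriction here as a map into the nonempty subsets of X is given. *)
#[short(type="completeMetricType")]
HB.structure Definition CompleteMetric (K : numDomainType) :=
  {M of Complete M & Metric K M}.

Section hausdorff_distance.
Context {R : realType} {X : metricType R}.
Implicit Types (x y : X) (A B C : set X).

Definition point_set_dist x B : R := inf [set mdist x y | y in B].

Definition excess A B : R := sup [set point_set_dist x B | x in A].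

Definition hausdorff_dist A B : R := Num.max (excess A B) (excess B A).

Lemma point_set_dist_le x y B : B y -> point_set_dist x B <= mdist x y.
Proof.
move=> By; apply: ge_inf; last by exists y.
by exists 0 => _ [z _ <-]; exact: mdist_ge0.
Qed.

Lemma point_set_dist_ge0 x B : B !=set0 -> 0 <= point_set_dist x B.
Proof.
move=> [b Bb]; apply: lb_le_inf; first by exists (mdist x b), b.
by move=> _ [z _ <-]; exact: mdist_ge0.
Qed.

Lemma point_set_dist_lt x B e : B !=set0 -> point_set_dist x B < e ->
  exists2 y, B y & mdist x y < e.
Proof.
move=> [b Bb] /inf_lt []; first by exists (mdist x b), b.
by move=> _ [y By <-] xy; exists y.
Qed.

Lemma compact_mdist_bounded x A : compact A ->
  exists M, forall y, A y -> mdist x y <= M.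
Proof.
move=> cA; have [->|/set0P A0] := eqVneq A set0; first by exists 0.
have cf : continuous (fun y => mdist x y : R).
  move=> y; apply/cvgrPdist_lt => e e0.
  apply/nbhs_ballP; exists e => //= z; rewrite ballEmdist/= => yz.
  rewrite (le_lt_trans _ yz)// ler_norml; apply/andP; split.
    by rewrite lerBrDl lerBlDr; exact: metric_triangle.
  by rewrite lerBlDr addrC (metric_sym y z); exact: metric_triangle.
have [c _ cmax] := compact_EVT_max A0 cA (continuous_subspaceT cf).
by exists (mdist x c) => y Ay; apply: cmax; rewrite inE.
Qed.

Lemma point_set_dist_le_excess x A B : B !=set0 -> compact A -> A x ->
  point_set_dist x B <= excess A B.
Proof.
move=> [b Bb] cA Ax; have [M AM] := compact_mdist_bounded b cA.
apply: ub_le_sup; last by exists x.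
exists M => _ [y Ay <-]; rewrite (le_trans (point_set_dist_le y Bb))//.
by rewrite metric_sym AM.
Qed.

Lemma excess_le A B e : A !=set0 ->
  (forall x, A x -> point_set_dist x B <= e) -> excess A B <= e.
Proof.
move=> [a Aa] Ae; apply: ge_sup; first by exists (point_set_dist a B), a.
by move=> _ [x Ax <-]; exact: Ae.
Qed.

Lemma excess_triangle A B C : A !=set0 -> B !=set0 -> C !=set0 ->
  compact A -> compact B -> excess A C <= excess A B + excess B C.
Proof.
move=> A0 B0 C0 cA cB; apply: excess_le => // x Ax.
apply/ler_addgt0Pl => e e0.
have xB : point_set_dist x B < excess A B + e / 2.
  by rewrite (le_lt_trans (point_set_dist_le_excess _ _ Ax))// ltrDl divr_gt0.
have [y By xy] := point_set_dist_lt B0 xB.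
have yC : point_set_dist y C < excess B C + e / 2.
  by rewrite (le_lt_trans (point_set_dist_le_excess _ _ By))// ltrDl divr_gt0.
have [z Cz yz] := point_set_dist_lt C0 yC.
rewrite (le_trans (point_set_dist_le x Cz))//.
rewrite (le_trans (metric_triangle x y z))//.
by rewrite [e]splitr addrACA lerD// addrC ltW.
Qed.

Lemma excess_le0 A B : B !=set0 -> compact A -> compact B ->
  excess A B <= 0 -> A `<=` B.
Proof.
move=> B0 cA cB AB x Ax.
have : closed B by apply: compact_closed => //; exact: metric_hausdorff.
apply => U /nbhs_ballP[e /= e0 xU].
have xB : point_set_dist x B < e.
  by rewrite (le_lt_trans _ e0)// (le_trans _ AB)// point_set_dist_le_excess.
have [y By xy] := point_set_dist_lt B0 xB.
by exists y; split => //; apply: xU; rewrite ballEmdist.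
Qed.

End hausdorff_distance.

(* The hyperspace of nonempty compact subsets of X. *)
Record hyperspace (R : realType) (X : metricType R) := Hyperspace {
  hyperspace_set :> set X ;
  hyperspace_nonempty : hyperspace_set !=set0 ;
  hyperspace_compact : compact hyperspace_set }.

Arguments hyperspace_compact {R X} h : rename.

Section hyperspace_metric.
Context {R : realType} {X : metricType R}.
Local Notation KX := (@hyperspace R X).
Implicit Types A B C : KX.

Let KX_eq A B : (A : set X) = B -> A = B.
Proof.
case: A B => [A A0 cA] [B B0 cB] /= AB.
by case: _ / AB in B0 cB *; congr Hyperspace; exact: Prop_irrelevance.
Qed.

Let dH A B : R := hausdorff_dist A B.

Let dHxx A : dH A A = 0.
Proof.
have A0 := hyperspace_nonempty A; have cA := hyperspace_compact A.
rewrite /dH /hausdorff_dist maxxx; apply/eqP; rewrite eq_le; apply/andP; split.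
  by apply: excess_le => // x Ax; rewrite -(mdistxx x) point_set_dist_le.
have [a Aa] := A0.
by rewrite (le_trans (point_set_dist_ge0 a A0))// point_set_dist_le_excess.
Qed.

Let dH_positivity A B : dH A B = 0 -> A = B.
Proof.
have A0 := hyperspace_nonempty A; have cA := hyperspace_compact A.
have B0 := hyperspace_nonempty B; have cB := hyperspace_compact B.
rewrite /dH /hausdorff_dist => AB; apply: KX_eq; apply/seteqP; split.
  by apply: excess_le0 => //; rewrite -AB le_max lexx.
by apply: excess_le0 => //; rewrite -AB le_max lexx orbT.
Qed.

Let dH_sym A B : dH A B = dH B A.
Proof. by rewrite /dH /hausdorff_dist maxC. Qed.

Let dH_triangle B A C : dH A C <= dH A B + dH B C.
Proof.
have A0 := hyperspace_nonempty A; have cA := hyperspace_compact A.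
have B0 := hyperspace_nonempty B; have cB := hyperspace_compact B.
have C0 := hyperspace_nonempty C; have cC := hyperspace_compact C.
rewrite /dH /hausdorff_dist ge_max; apply/andP; split.
  rewrite (le_trans (excess_triangle A0 B0 C0 cA cB))//.
  by rewrite lerD// le_max lexx.
rewrite (le_trans (excess_triangle C0 B0 A0 cC cB))// addrC.
by rewrite lerD// le_max lexx orbT.
Qed.

HB.instance Definition _ := gen_eqMixin KX.
HB.instance Definition _ := gen_choiceMixin KX.
HB.instance Definition _ :=
  isMetric.Build R KX dHxx dH_positivity dH_sym dH_triangle.

Lemma hyperspace_mdistE A B : mdist A B = hausdorff_dist A B.
Proof. by []. Qed.

End hyperspace_metric.

(* [lim] requires a pointed codomain; [completeMetricType] provides a point. *)
Section hyperspace_pointed.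
Context {R : realType} {X : completeMetricType R}.

Definition hyperspace_point : hyperspace X :=
  Hyperspace (ex_intro _ point erefl) (@compact_set1 X point).

HB.instance Definition _ := isPointed.Build (hyperspace X) hyperspace_point.

End hyperspace_pointed.

Section riesz_variation.
Context {R : realType} {X : completeMetricType R}.
Implicit Types (g : R -> R) (F : R -> hyperspace X) (p s t tau : R).

Definition holder_wrt g F (a b alpha : R) :=
  exists2 L : R, 0 <= L & forall s t, s \in `[a, b] -> t \in `[a, b] ->
    mdist (F s) (F t) <= L * `|g t - g s| `^ alpha.

Definition riesz_term p g F (u v : R) : \bar R :=
  if g v == g u then (if F v == F u then 0%E else +oo%E)
  else ((mdist (F v) (F u)) `^ p / (g v - g u) `^ (p - 1))%:E.

(* As in [itv_partition], the seq [P] omits the initial point [s]. *)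
Definition riesz_sum p g F s (P : seq R) : \bar R :=
  let u := nth s (s :: P) in
  (\sum_(0 <= i < size P) riesz_term p g F (u i) (u i.+1))%E.

Definition riesz_variation p g F s t : \bar R :=
  ereal_sup [set riesz_sum p g F s P | P in itv_partition s t].

Definition right_jump g tau : R := lim (g r @[r --> tau^'+]) - g tau.

Definition set_jump F tau : R := mdist (lim (F r @[r --> tau^'+])) (F tau).

End riesz_variation.

(* Main.v *)
Require Import Defs.
From mathcomp Require Import all_boot all_order all_algebra.
From mathcomp Require Import all_classical all_reals all_analysis.
From mathcomp Require Import ring lra.
Import Order.TTheory GRing.Theory Num.Theory.
Import numFieldNormedType.Exports.
Local Open Scope classical_set_scope.
Local Open Scope ring_scope.

Set Implicit Arguments.
Unset Strict Implicit.
Unset Printing Implicit Defensive.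

(* Write m(tau) for the jump terms.  Since alpha > 1, F moves by o(|dg|) away
   from the jumps of g.  For each slope c >= 0, Young's inequality gives
   p c^(p-1) J(tau) <= m(tau) + (p-1) c^p Delta(tau), and a supremum argument
   along [u, v] propagates this to
     p c^(p-1) d(F u, F v) <= sum_[u,v) m + (p-1) c^p (g v - g u).
   Taking c = d(F u, F v) / (g v - g u) bounds each Riesz term by the mass of
   the jumps in [u, v), and these bounds add up over a partition.  Conversely
   the terms over [tau, r] tend to m(tau) as r decreases to tau, so that
   finitely many jumps can be captured by a single partition.  Right limits of F
   exist because the hyperspace is complete. *)

(** * Completeness of the hyperspace for the Hausdorff distance *)

Lemma mdist_hyperspace_lt (R : realType) (X : metricType R)
    (A B : hyperspace X) (e : R) (x : X) :
  mdist A B < e -> hyperspace_set A x ->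
  exists2 y, hyperspace_set B y & mdist x y < e.
Proof.
move=> ABe Ax; apply: point_set_dist_lt; first exact: hyperspace_nonempty.
apply: le_lt_trans ABe; rewrite hyperspace_mdistE /hausdorff_dist le_max.
rewrite point_set_dist_le_excess//; first exact: hyperspace_nonempty.
exact: hyperspace_compact.
Qed.

Lemma mdist_hyperspace_le (R : realType) (X : metricType R)
    (A B : hyperspace X) (e : R) :
  (forall x, hyperspace_set A x ->
     exists2 y, hyperspace_set B y & mdist x y <= e) ->
  (forall y, hyperspace_set B y ->
     exists2 x, hyperspace_set A x & mdist x y <= e) ->
  mdist A B <= e.
Proof.
move=> AB BA; rewrite hyperspace_mdistE /hausdorff_dist ge_max.
apply/andP; split; (apply: excess_le; first exact: hyperspace_nonempty).
  by move=> x /AB[y By]; apply: le_trans; exact: point_set_dist_le.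
move=> y /BA[x Ax]; rewrite metric_sym; apply: le_trans.
exact: point_set_dist_le.
Qed.

Lemma exists_exprV2_lt (R : realType) (d : R) : 0 < d ->
  exists n, 2^-1 ^+ n < d.
Proof.
move=> d0; exists (Num.bound d^-1); rewrite exprVn -[ltRHS]invrK.
rewrite ltf_pV2 ?posrE ?invr_gt0 ?exprn_gt0//.
exact: upper_nthrootP.
Qed.

Section hyperspace_complete.
Context {R : realType} {X : completeMetricType R}.
Variable Phi : set_system (hyperspace X).
Context {PhiF : ProperFilter Phi}.

(* The lower Kuratowski limit of the filter; for a Cauchy filter it is also the
   limit in the Hausdorff distance. *)
Definition lower_limit : set X :=
  [set x | forall e : R, 0 < e ->
    \forall B \near Phi, exists2 y, hyperspace_set B y & mdist x y < e].

Let e (n : nat) : R := 2^-1 ^+ n.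

Let e_gt0 n : 0 < e n. Proof. by rewrite exprn_gt0. Qed.

Let eS n : e n.+1 = e n / 2. Proof. by rewrite /e exprSr. Qed.

Let e_small (d k : R) : 0 < d -> 0 < k -> exists n, k * e n < d.
Proof.
move=> d0 k0; have [n nd] := exists_exprV2_lt (divr_gt0 d0 k0).
by exists n; rewrite mulrC -ltr_pdivlMr.
Qed.

Variable A : nat -> hyperspace X.
Hypothesis AP : forall n, \forall B \near Phi, mdist (A n) B < e n.

(** As [Phi] is proper, a single [B] is close to both [A n] and [A n.+1], at total cost
    [e n + e n / 2]. *)
Let A_next n x : hyperspace_set (A n) x ->
  exists2 y, hyperspace_set (A n.+1) y & mdist x y < 2 * e n.
Proof.
move=> Anx.
have [B [AnB ASB]] := filter_ex (filterI (AP n) (AP n.+1)).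
apply: (@mdist_hyperspace_lt _ _ (A n)) => //.
rewrite (le_lt_trans (metric_triangle _ B _))// [mdist B _]metric_sym.
by have := e_gt0 n; move: AnB ASB => /=; rewrite eS; lra.
Qed.

(** Iterating [A_next] from [x] gives a sequence with steps below [2 * e (n + k)], which sum to
    [4 * e n]. It is Cauchy, and completeness of [X] provides the point of [lower_limit]. *)
Let approx_near n x : hyperspace_set (A n) x ->
  exists2 y, lower_limit y & mdist x y <= 4 * e n.
Proof.
move=> Anx.
(* Membership is a premise inside the choice, so [next] is total; its value off [A k] is
   arbitrary. *)
have /choice[next nextP] : forall p : nat * X, exists y,
    hyperspace_set (A p.1) p.2 ->
    hyperspace_set (A p.1.+1) y /\ mdist p.2 y < 2 * e p.1.
  move=> [k y]/=.
  have [/A_next[z Az yz]|nA] := pselect (hyperspace_set (A k) y).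
    by exists z.
  by exists y.
pose z := fix z k := if k is j.+1 then next ((n + j)%N, z j) else x.
have zA k : hyperspace_set (A (n + k)) (z k).
  elim: k => [|k ih]; first by rewrite addn0.
  by rewrite addnS; have [] := nextP (n + k, z k)%N ih.
have zS k : mdist (z k) (z k.+1) < 2 * e (n + k).
  by have [] := nextP (n + k, z k)%N (zA k).
(* The subtracted tail lets the induction close: [2 * e i = 4 * e i - 4 * e i.+1]. *)
have zD k j : mdist (z k) (z (k + j)%N) <= 4 * e (n + k) - 4 * e (n + (k + j)).
  elim: j => [|j ih]; first by rewrite addn0 mdistxx subrr.
  rewrite (le_trans (metric_triangle _ (z (k + j)%N) _))// addnS.
  by have := zS (k + j)%N; rewrite addnS eS; lra.
have zle k j : (k <= j)%N -> mdist (z k) (z j) <= 4 * e (n + k).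
  move=> kj; rewrite -(subnKC kj); apply: le_trans (zD _ _) _.
  by have := e_gt0 (n + (k + (j - k))); lra.
have eD k m : e (k + m) <= e m.
  rewrite /e exprD ler_piMl ?exprn_ge0 ?exprn_ile1 ?invr_ge0//.
  by rewrite invf_le1// ler1n.
have : cvg (z @ \oo).
  apply: cauchy_cvg; apply: cauchy_exP => d d0.
  have [k kd] := @e_small d 4 d0 ltac:(by []).
  exists (z k); exists k => // j /= kj; rewrite ballEmdist/=.
  by rewrite (le_lt_trans (zle _ _ kj))// (le_lt_trans _ kd)// ler_pM2l.
move=> /cvg_ex[y zy].
have zky k : mdist (z k) y <= 4 * e (n + k).
  apply/ler_addgt0Pr => d d0.
  have zyd : \forall j \near \oo, mdist y (z j) < d.
    exact: metricType_numDomainType.cvgr_dist_lt.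
  have [j /= [kj yj]] := filter_ex (filterI (nbhs_infty_ge k) zyd).
  rewrite (le_trans (metric_triangle _ (z j) _))// lerD//; first exact: zle.
  by rewrite metric_sym ltW.
exists y; last by have := zky 0; rewrite addn0.
(* The factor 5 is 4 for the distance from [y] to [z k] plus 1 for that from [A (n + k)] to [B]. *)
move=> d d0; have [k kd] := @e_small d 5 d0 ltac:(by []).
apply: filterS (AP (n + k)) => B AB.
have [w Bw zw] := mdist_hyperspace_lt AB (zA k).
exists w => //; rewrite (le_lt_trans (metric_triangle _ (z k) _))//.
rewrite metric_sym.
by have := zky k; have := eD n k; lra.
Qed.

Let limit_near n x : lower_limit x ->
  exists2 y, hyperspace_set (A n) y & mdist x y < 2 * e n.
Proof.
move=> /(_ _ (e_gt0 n)) Lx.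
have [B [AB [y By xy]]] := filter_ex (filterI (AP n) Lx).
rewrite metric_sym in AB; have [w Aw yw] := mdist_hyperspace_lt AB By.
exists w => //; rewrite (le_lt_trans (metric_triangle _ y _))//.
by move: xy yw; lra.
Qed.

Let lower_limit_nonempty : lower_limit !=set0.
Proof.
have [x Ax] := hyperspace_nonempty (A 0).
by have [y Ly _] := approx_near Ax; exists y.
Qed.

(* Composing an ultrafilter on the limit set with nearest points in the compact
   set [A n] shows that it is Cauchy. *)
Let lower_limit_compact : compact lower_limit.
Proof.
rewrite compact_ultra => G GU GL.
have Gy : cvg G.
  apply: cauchy_cvg; apply: cauchy_exP => d d0.
  (* The factor 3 is 2 for the distance from [x] to [pi x] plus 1 for that from [pi x] to the
     cluster point [a]. *)
  have [n nd] := @e_small d 3 d0 ltac:(by []).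
  have /choice[pi piP] : forall x, exists y, lower_limit x ->
      hyperspace_set (A n) y /\ mdist x y < 2 * e n.
    move=> x; have [/(limit_near n)[y Ay xy]|nL] := pselect (lower_limit x).
      by exists y.
    by exists x.
  have piA : G (pi @^-1` hyperspace_set (A n)).
    by apply: filterS GL => x /piP[].
  have [a [Aa Ga]] := hyperspace_compact (A n) (pi @ G) _ piA.
  (* The ultrafilter contains the preimage of the ball around [a] or that of its complement; the
     latter contradicts that [a] is a cluster point. *)
  exists a; have [|] := in_ultra_setVsetC (pi @^-1` ball a (e n)) GU.
    move=> Gb; apply: filterS (filterI Gb GL) => x [/=].
    rewrite !ballEmdist/= => ax /piP[_].
    rewrite metric_sym => xp.
    by rewrite (le_lt_trans (metric_triangle _ (pi x) _))//; lra.
  move=> Gb.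
  by have [y []] := Ga (~` ball a (e n)) _ Gb (nbhsx_ballx _ _ (e_gt0 n)).
move/cvg_ex : Gy => [y Gy]; exists y; split => // d d0.
have d20 : 0 < d / 2 by rewrite divr_gt0.
have Gyd : \forall x \near G, mdist y x < d / 2.
  by move/metricType_numDomainType.fcvgrPdist_lt : Gy; exact.
have [x [Lx xy]] := filter_ex (filterI GL Gyd).
apply: filterS (Lx _ d20) => B [w Bw xw]; exists w => //.
by rewrite (le_lt_trans (metric_triangle _ x _))//; move: xy xw => /=; lra.
Qed.

(** [limit_near] and [approx_near] put [A n] within [4 * e n] of the limit set, and [AP] adds
    [e n]. *)
Lemma lower_limit_cvg : cvg Phi.
Proof.
apply/cvg_ex; exists (Hyperspace lower_limit_nonempty lower_limit_compact).
apply/metricType_numDomainType.fcvgrPdist_lt => d d0.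
have [n nd] := @e_small d 5 d0 ltac:(by []).
apply: filterS (AP n) => B AB.
rewrite (le_lt_trans (metric_triangle _ (A n) _))//.
rewrite (@lt_le_trans _ _ (4 * e n + e n))//; last by move: nd; lra.
rewrite ler_ltD//; apply: mdist_hyperspace_le => /= x.
  move=> /(limit_near n)[y Ay xy]; exists y => //.
  by have := e_gt0 n; move: xy; lra.
by move=> /approx_near[y Ly xy]; exists y => //; rewrite metric_sym.
Qed.

End hyperspace_complete.

Lemma hyperspace_cauchy_cvg (R : realType) (X : completeMetricType R)
    (Phi : set_system (hyperspace X)) (PhiF : ProperFilter Phi) :
  cauchy Phi -> cvg Phi.
Proof.
move=> /cauchyP Phic.
have /choice[A AP] : forall n, exists A, \forall B \near Phi,
    mdist A B < 2^-1 ^+ n :> R.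
  move=> n; have [|A PA] := Phic (2^-1 ^+ n); first by rewrite exprn_gt0.
  by exists A; rewrite ballEmdist in PA.
exact: lower_limit_cvg AP.
Qed.

(** * From local to global estimates, and Young's inequality *)

Lemma mdist_le_of_local (R : realType) (Y : metricType R) (f : R -> Y)
    (H : R -> R) (K u v : R) :
  0 <= K -> u <= v ->
  {in `[u, v] &, nondecreasing_fun H} ->
  (forall x, u < x -> x <= v -> f r @[r --> x^'-] --> f x) ->
  (forall x, u <= x -> x < v ->
     exists2 r, x < r <= v & K * mdist (f x) (f r) <= H r - H x) ->
  K * mdist (f u) (f v) <= H v - H u.
Proof.
move=> K0 uv Hnd fleft fstep.
(* Continuous induction: left continuity of [f] and monotonicity of [H] put the supremum [c] of [S]
   into [S], and [fstep] would then exceed it if [c < v]. *)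
pose S := [set x | u <= x <= v /\ K * mdist (f u) (f x) <= H x - H u].
have Su : S u by rewrite /S/= lexx uv mdistxx mulr0 subrr.
have Sv : ubound S v by move=> x [/andP[]].
have supS : has_sup S by split; [exists u | exists v].
set c := sup S.
have uc : u <= c by apply: ub_le_sup => //; exists v.
have cv : c <= v by apply: ge_sup => //; exists u.
have Sc : S c.
  split; first by rewrite uc cv.
  apply/ler_addgt0Pr => e e0.
  have [->|cu] := eqVneq c u; first by rewrite mdistxx mulr0 subrr add0r ltW.
  have {}cu : u < c by rewrite lt_neqAle eq_sym cu.
  (* Dividing by [K + 1] also covers [K = 0]. *)
  have eK : 0 < e / (K + 1) by rewrite divr_gt0// ltr_wpDl.
  have : \forall r \near c^'-, mdist (f c) (f r) < e / (K + 1).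
    exact: (metricType_numDomainType.cvgr_dist_lt (fleft c cu cv)).
  move=> [d /= d0 dP].
  have [y Sy cdy] := sup_adherent d0 supS.
  have yc : y <= c by apply: ub_le_sup => //; exists v.
  have [uyv Ky] := Sy.
  have HyHc : H y <= H c by apply: Hnd; rewrite ?in_itv//= uc cv.
  suff : K * mdist (f y) (f c) <= e.
    have := ler_wpM2l K0 (metric_triangle (f u) (f y) (f c)).
    by rewrite mulrDr; lra.
  move: yc; rewrite le_eqVlt => /predU1P[->|yc].
    by rewrite mdistxx mulr0 ltW.
  have := dP y; rewrite /ball_/= gtr0_norm ?subr_gt0// => /(_ _ yc).
  move=> /(_ ltac:(rewrite /c; lra)) fcy.
  rewrite metric_sym; apply: (@le_trans _ _ (K * (e / (K + 1)))).
    by rewrite ler_wpM2l// ltW.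
  rewrite mulrCA ler_piMr//; first exact: ltW.
  by rewrite ler_pdivrMr ?ltr_wpDl// mul1r lerDl.
move: cv; rewrite le_eqVlt => /predU1P[<-|cv]; first by case: Sc.
have [r /andP[cr rv] Kr] := fstep c uc cv.
have : S r.
  split; first by rewrite rv (le_trans uc)// ltW.
  case: Sc => _ Kc; have := ler_wpM2l K0 (metric_triangle (f u) (f c) (f r)).
  by rewrite mulrDr; lra.
move=> Sr; have : r <= c by apply: ub_le_sup => //; exists v.
by rewrite leNgt cr.
Qed.

(** Young's inequality for [j / d] and [c ^ (p - 1)] with exponents [p] and [p / (p - 1)],
    multiplied by [p * d]. It bounds the quotient from below by an expression affine in [j] and
    [d]. *)
Lemma young_powR (R : realType) (p c j d : R) : 1 < p -> 0 <= c -> 0 <= j ->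
  0 < d -> p * c `^ (p - 1) * j <= j `^ p / d `^ (p - 1) + (p - 1) * c `^ p * d.
Proof.
move=> p1 c0 j0 d0.
have p0 : 0 < p by lra.
have pB0 : 0 < p - 1 by lra.
have := @conjugate_powR R (j / d) (c `^ (p - 1)) p (p / (p - 1)).
have jd0 : 0 <= j / d by rewrite divr_ge0// ltW.
have q0 : 0 < p / (p - 1) by rewrite divr_gt0.
move=> /(_ jd0 (powR_ge0 _ _) p0 q0).
have -> : p^-1 + (p / (p - 1))^-1 = 1 by field; apply/andP; split; lra.
move=> /(_ erefl).
rewrite -powRrM (_ : (p - 1) * (p / (p - 1)) = p); last by field; lra.
have jdE : (j / d) `^ p = j `^ p / d `^ (p - 1) / d.
  rewrite powRM// ?invr_ge0 ?(ltW d0)// -[d^-1 in LHS]powR_inv1 ?(ltW d0)//.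
  rewrite -powRrM mulN1r powRN -(mulr_powRB1 (ltW d0) p0).
  by field; rewrite !gt_eqF ?powR_gt0.
rewrite jdE => H; have := ler_wpM2l (ltW (mulr_gt0 p0 d0)) H.
set A := _ `^ (p - 1); set B := _ / _ `^ _.
have -> : p * d * (j / d * A) = p * A * j by field; rewrite gt_eqF.
have -> // : p * d * (B / d / p + c `^ p / (p / (p - 1))) =
  B + (p - 1) * c `^ p * d.
by field; rewrite !gt_eqF.
Qed.

(** The equality case [c = j / d] of [young_powR], through which affine bounds give back the exact
    quotient. *)
Lemma young_powR_eq (R : realType) (p j d : R) : 1 < p -> 0 <= j -> 0 < d ->
  p * (j / d) `^ (p - 1) * j =
  j `^ p / d `^ (p - 1) + (p - 1) * (j / d) `^ p * d.
Proof.
move=> p1 j0 d0.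
have p0 : 0 < p by lra.
have jd0 : 0 <= j / d by rewrite divr_ge0// ltW.
have E : j `^ p / d `^ (p - 1) = j * (j / d) `^ (p - 1).
  rewrite powRM// ?invr_ge0 ?(ltW d0)// -[d^-1]powR_inv1 ?(ltW d0)//.
  by rewrite -powRrM mulN1r powRN mulrA mulr_powRB1.
rewrite E -(mulr_powRB1 jd0 p0).
by field; rewrite gt_eqF.
Qed.

Lemma powR_small (R : realType) (L q e : R) : 0 <= L -> 0 < q -> 0 < e ->
  exists2 eta : R, 0 < eta &
    forall x, 0 <= x -> x <= eta -> L * x `^ q <= e.
Proof.
move=> L0 q0 e0; have L1 : 0 < L + 1 by lra.
have eL := divr_gt0 e0 L1.
exists ((e / (L + 1)) `^ q^-1) => [|x x0 xe]; first exact: powR_gt0.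
have : x `^ q <= e / (L + 1).
  have -> : e / (L + 1) = ((e / (L + 1)) `^ q^-1) `^ q.
    by rewrite -powRrM mulVf ?gt_eqF// powRr1// ltW.
  by apply: ge0_ler_powR; rewrite ?nnegrE ?powR_ge0 ?(ltW q0).
rewrite ler_pdivlMr// => xe'; rewrite mulrC.
by apply: le_trans xe'; rewrite ler_wpM2l ?powR_ge0// lerDl.
Qed.

Lemma nondecreasing_itv_le (R : realType) (a b : R) (g : R -> R) :
  {in `[a, b] &, nondecreasing_fun g} ->
  forall x y, a <= x -> x <= y -> y <= b -> g x <= g y.
Proof.
move=> gnd x y ax xy yb; apply: gnd => //; rewrite in_itv/=.
  by rewrite ax (le_trans xy).
by rewrite yb (le_trans ax).
Qed.

(** * One-sided limits of [g] and [F], and the size of the jumps *)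

Section jumps.
Context {R : realType} {X : completeMetricType R}.
Variables (a b : R) (g : R -> R) (F : R -> hyperspace X).
Hypothesis gleft : forall t, a < t -> t <= b -> g r @[r --> t^'-] --> g t.
Hypothesis gnd : {in `[a, b] &, nondecreasing_fun g}.

(* All that is used of the Hölder condition with exponent alpha > 1. *)
Definition infinitesimal_wrt :=
  forall e : R, 0 < e -> exists2 eta : R, 0 < eta & forall x y,
    a <= x -> x <= y -> y <= b -> g y - g x <= eta ->
    mdist (F x) (F y) <= e * (g y - g x).

Let g_le := nondecreasing_itv_le gnd.

(** One factor of [(g y - g x) ^ alpha] is split off; the remaining power [alpha - 1 > 0] makes the
    other factor small. *)
Lemma holder_infinitesimal alpha : 1 < alpha -> holder_wrt g F a b alpha ->
  infinitesimal_wrt.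
Proof.
move=> alpha1 [L L0 gF] e e0.
have alphaB1 : 0 < alpha - 1 by rewrite subr_gt0.
have [eta eta0 etaP] := powR_small L0 alphaB1 e0.
exists eta => // x y ax xy yb gxy.
have gxy0 : 0 <= g y - g x by rewrite subr_ge0 g_le.
apply: le_trans (gF x y _ _) _; rewrite ?in_itv/= ?ax ?yb ?(le_trans xy)//.
  by rewrite (le_trans ax).
rewrite ger0_norm// -mulr_powRB1//; last by lra.
by rewrite mulrCA mulrC ler_wpM2r// etaP.
Qed.

Section right_limits.
Variable x : R.
Hypotheses (ax : a <= x) (xb : x < b).

Lemma right_jump_cvg : g r @[r --> x^'+] --> g x + right_jump g x.
Proof.
rewrite /right_jump addrC subrK; apply: nondecreasing_at_right_is_cvgr.
  near=> r => y z /[!in_itv]/= /andP[xy yr] /andP[xz zr] yz.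
  have rb : r < b by near: r; exact: nbhs_right_lt.
  apply: g_le => //; first by rewrite (le_trans ax)// ltW.
  by rewrite ltW// (lt_trans zr).
near=> r; exists (g x) => _ [y /=/[!in_itv]/= /andP[xy yr] <-].
have rb : r < b by near: r; exact: nbhs_right_lt.
by apply: g_le => //; [exact: ltW|rewrite ltW// (lt_trans yr)].
Unshelve. all: by end_near. Qed.

Lemma right_jump_le r : x < r -> r <= b -> right_jump g x <= g r - g x.
Proof.
move=> xr rb; rewrite lerBrDl.
apply: (cvgr_to_le right_jump_cvg).
near=> y.
have yr : y < r by near: y; exact: nbhs_right_lt.
have xy : x < y by near: y; exact: nbhs_right_gt.
by apply: g_le => //; [rewrite (le_trans ax)// ltW|exact: ltW].
Unshelve. all: by end_near. Qed.

Lemma right_jump_ge0 : 0 <= right_jump g x.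
Proof.
rewrite -(lerD2l (g x)) addr0; apply: (cvgr_to_ge right_jump_cvg).
near=> r; have rb : r < b by near: r; exact: nbhs_right_lt.
by apply: g_le => //; exact: ltW.
Unshelve. all: by end_near. Qed.

Lemma near_right_jump e : 0 < e ->
  \forall r \near x^'+, g r - g x <= right_jump g x + e.
Proof.
move=> e0; move/cvgrPdist_le : right_jump_cvg => /(_ e e0).
by apply: filterS => r; rewrite ler_norml => /andP[]; lra.
Qed.

Hypothesis Finf : infinitesimal_wrt.

(** Strictly to the right of [x] the jump of [g] is already spent, so [g] varies arbitrarily little
    there and [F] is Cauchy at [x^'+]. *)
Lemma set_jump_cvg : F r @[r --> x^'+] --> lim (F r @[r --> x^'+]).
Proof.
apply: hyperspace_cauchy_cvg; apply: cauchy_exP => e e0.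
have [eta eta0 Feta] := @Finf 1 ltr01.
pose d := Num.min eta (e / 2).
have d0 : 0 < d by rewrite lt_min eta0 divr_gt0.
have Fr y z : x < y -> y <= z -> z < b -> g z - g x <= right_jump g x + d ->
    mdist (F y) (F z) < e.
  move=> xy yz zb gz.
  have gy := right_jump_le xy (le_trans yz (ltW zb)).
  have gyz : g z - g y <= d by lra.
  have /Feta : a <= y by rewrite (le_trans ax)// ltW.
  move=> /(_ z yz (ltW zb)); rewrite mul1r.
  have := gyz; rewrite /d le_min => /andP[-> gyze] /(_ isT).
  by move=> Fyz; rewrite (le_lt_trans Fyz)// (le_lt_trans gyze)//; lra.
near x^'+ => y; exists (F y); rewrite ballEmdist.
change (\forall z \near x^'+, mdist (F y) (F z) < e).
have xy : x < y by near: y; exact: nbhs_right_gt.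
have yb : y < b by near: y; exact: nbhs_right_lt.
near=> z.
have xz : x < z by near: z; exact: nbhs_right_gt.
have zb : z < b by near: z; exact: nbhs_right_lt.
have [yz|/ltW zy] := leP y z.
  by apply: Fr => //; near: z; exact: near_right_jump.
by rewrite metric_sym; apply: Fr => //; near: y; exact: near_right_jump.
Unshelve. all: by end_near. Qed.

Lemma near_set_jump e : 0 < e ->
  \forall r \near x^'+, mdist (lim (F r @[r --> x^'+])) (F r) <= e.
Proof.
move=> e0; have := set_jump_cvg.
by move/metricType_numDomainType.cvgrPdist_le; exact.
Qed.

(** Near [x] the motion of [F] splits into its jump at [x] and a part of slope [e], charged only to
    the increase of [g] beyond its own jump. *)
Lemma set_jump_le e : 0 < e -> exists2 r, x < r &
  r <= b /\ forall y, x < y -> y <= r ->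
    mdist (F x) (F y) <= set_jump F x + e * (g y - g x - right_jump g x).
Proof.
move=> e0; have [eta eta0 Feta] := Finf e0.
near x^'+ => r.
have xr : x < r by near: r; exact: nbhs_right_gt.
have rb : r < b by near: r; exact: nbhs_right_lt.
have gr : g r - g x <= right_jump g x + eta by near: r; exact: near_right_jump.
exists r => //; split; first exact: ltW.
move=> y xy yr; apply/ler_addgt0Pr => d d0.
(* The point [z] between [x] and [y] stands in for [x+]: [F z] is within [d] of the right limit, and
   the slope bound applies on [[z, y]]. *)
near x^'+ => z.
have xz : x < z by near: z; exact: nbhs_right_gt.
have zy : z < y by near: z; exact: nbhs_right_lt.
have Fz : mdist (lim (F r @[r --> x^'+])) (F z) <= d.
  by near: z; exact: near_set_jump.
have yb : y <= b by rewrite (le_trans yr)// ltW.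
have ay : a <= y by rewrite (le_trans ax)// ltW.
have gy : g y <= g r by apply: g_le => //; exact: ltW.
have gz : right_jump g x <= g z - g x.
  by apply: right_jump_le => //; rewrite (le_trans (ltW zy)).
have /Feta : a <= z by rewrite (le_trans ax)// ltW.
move=> /(_ y (ltW zy) yb) /(_ ltac:(lra)) Fzy.
have := metric_triangle (F x) (lim (F r @[r --> x^'+])) (F y).
have := metric_triangle (lim (F r @[r --> x^'+])) (F z) (F y).
rewrite [mdist (F x) (lim _)]metric_sym -/(set_jump F x).
have : e * (g y - g z) <= e * (g y - g x - right_jump g x).
  by rewrite ler_wpM2l ?(ltW e0)//; lra.
by lra.
Unshelve. all: by end_near. Qed.

Lemma set_jump_eq0 : right_jump g x = 0 -> set_jump F x = 0.
Proof.
move=> gx0; apply/eqP; rewrite eq_le mdist_ge0 andbT.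
apply/ler_addgt0Pr => e e0; rewrite add0r.
have [eta eta0 Feta] := @Finf 1 ltr01.
pose d := Num.min eta (e / 2).
have d0 : 0 < d by rewrite lt_min eta0 divr_gt0.
near x^'+ => r.
have xr : x < r by near: r; exact: nbhs_right_gt.
have rb : r < b by near: r; exact: nbhs_right_lt.
have : g r - g x <= right_jump g x + d by near: r; exact: near_right_jump.
rewrite gx0 add0r le_min => /andP[geta ge].
have Fr : mdist (lim (F r @[r --> x^'+])) (F r) <= e / 2.
  by near: r; apply: near_set_jump; exact: divr_gt0.
have := Feta x r ax (ltW xr) (ltW rb) geta.
rewrite mul1r [mdist (F x) _]metric_sym.
have := metric_triangle (lim (F r @[r --> x^'+])) (F r) (F x).
by rewrite -/(set_jump F x); lra.
Unshelve. all: by end_near. Qed.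

End right_limits.

Lemma infinitesimal_left_cvg x : infinitesimal_wrt -> a < x -> x <= b ->
  F r @[r --> x^'-] --> F x.
Proof.
move=> Finf ax xb; apply/metricType_numDomainType.cvgrPdist_le => e e0.
have [eta eta0 Feta] := @Finf 1 ltr01.
pose d := Num.min eta e.
have d0 : 0 < d by rewrite lt_min eta0.
near=> r.
have rx : r < x by near: r; exact: nbhs_left_lt.
have ar : a < r by near: r; exact: nbhs_left_gt.
have : `|g x - g r| <= d.
  by near: r; move/cvgrPdist_le : (gleft ax xb) => /(_ d d0).
rewrite ler_norml le_min => /andP[_ /andP[geta ge]].
rewrite metric_sym; apply: le_trans ge; rewrite -[leRHS]mul1r.
by apply: Feta => //; exact: ltW.
Unshelve. all: by end_near. Qed.

End jumps.

(** * Riesz sums under concatenation and telescoping *)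

Section riesz_sum.
Context {R : realType} {X : completeMetricType R}.
Variables (p : R) (g : R -> R) (F : R -> hyperspace X).

Lemma riesz_sum_nil u : riesz_sum p g F u [::] = 0%E.
Proof. by rewrite /riesz_sum big_geq. Qed.

Lemma riesz_sum_cons u v P :
  riesz_sum p g F u (v :: P) =
  (riesz_term p g F u v + riesz_sum p g F v P)%E.
Proof.
rewrite /riesz_sum /= big_nat_recl//=; congr (_ + _)%E.
(* The default of [nth] is the initial point, which changes from [u] to [v]; all indices are in
   range. *)
by apply: eq_big_nat => i /andP[_ iP]; rewrite !(set_nth_default v u)//= ltnW.
Qed.

Lemma riesz_sum_cat u P Q :
  riesz_sum p g F u (P ++ Q) =
  (riesz_sum p g F u P + riesz_sum p g F (last u P) Q)%E.
Proof.
elim: P u => [|v P ih] u /=; first by rewrite riesz_sum_nil add0e.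
by rewrite !riesz_sum_cons ih addeA.
Qed.

Lemma riesz_sum_le_telescope (N : R -> R) s t P :
  (forall u v, s <= u -> u < v -> v <= t ->
    (riesz_term p g F u v <= (N v - N u)%:E)%E) ->
  itv_partition s t P -> (riesz_sum p g F s P <= (N t - N s)%:E)%E.
Proof.
elim: P s => [|v P ih] s H sP.
  by rewrite riesz_sum_nil (itv_partition_nil sP) subrr.
have vP := itv_partition_cons sP; have vt := itv_partition_le vP.
have sv : s < v by case: sP => /= /andP[].
rewrite riesz_sum_cons (_ : N t - N s = (N v - N s) + (N t - N v)); last lra.
rewrite EFinD leeD// ?H//; apply: ih => // x y vx.
by apply: H; rewrite (le_trans (ltW sv)).
Qed.

End riesz_sum.

(** * Upper and lower bounds of the variation by the jump sum *)

Section identity.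
Context {R : realType} {X : completeMetricType R}.
Variables (a b p : R) (g : R -> R) (F : R -> hyperspace X).
Hypothesis gleft : forall t, a < t -> t <= b -> g r @[r --> t^'-] --> g t.
Hypothesis gnd : {in `[a, b] &, nondecreasing_fun g}.
Hypothesis Finf : infinitesimal_wrt a b g F.
Hypothesis p1 : 1 < p.

Let p0 : 0 < p. Proof. by rewrite (lt_trans _ p1). Qed.

Let g_le := nondecreasing_itv_le gnd.

Let m tau := (set_jump F tau) `^ p / (right_jump g tau) `^ (p - 1).

Let m_ge0 tau : 0 <= m tau.
Proof. by rewrite divr_ge0 ?powR_ge0. Qed.

Let m_jump0 tau : a <= tau -> tau < b -> right_jump g tau = 0 -> m tau = 0.
Proof.
move=> atau taub /(set_jump_eq0 gnd atau taub Finf) J0.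
by rewrite /m J0 powR0 ?mul0r// gt_eqF.
Qed.

Let young_jump tau c : a <= tau -> tau < b -> 0 <= c ->
  p * c `^ (p - 1) * set_jump F tau <=
  m tau + (p - 1) * c `^ p * right_jump g tau.
Proof.
move=> atau taub c0; have := right_jump_ge0 gnd atau taub.
rewrite le_eqVlt => /predU1P[/esym j0|j0].
  by rewrite (set_jump_eq0 gnd atau taub Finf)// j0 !mulr0 addr0.
by apply: young_powR => //; exact: mdist_ge0.
Qed.

Section upper_bound.
Variables (s t : R) (N : R -> R).
Hypotheses (as_ : a <= s) (tb : t <= b).
(** [N x] stands for the mass of the jumps in [[s, x)]: a jump at [x] counts only strictly after
    [x], as befits a left-continuous [g]. *)
Hypothesis N_jump : forall x r, s <= x -> x < r -> r <= t -> N x + m x <= N r.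

Let N_le x r : s <= x -> x <= r -> r <= t -> N x <= N r.
Proof.
move=> sx; rewrite le_eqVlt => /predU1P[->//|xr rt].
by apply: le_trans (N_jump sx xr rt); rewrite lerDl.
Qed.

Let mdist_le_slope c e u v : 0 <= c -> 0 < e -> s <= u -> u <= v -> v <= t ->
  p * c `^ (p - 1) * mdist (F u) (F v) <=
  N v - N u + ((p - 1) * c `^ p + e) * (g v - g u).
Proof.
move=> c0 e0 su uv vt.
set K := p * _; set lam := (p - 1) * _.
have K0 : 0 <= K by rewrite mulr_ge0 ?powR_ge0// ltW.
have lam0 : 0 <= lam by rewrite mulr_ge0 ?powR_ge0// subr_ge0 ltW.
have au : a <= u by rewrite (le_trans as_).
have vb : v <= b by rewrite (le_trans vt).
(* The local-to-global principle is applied to this [H]; the extra slope [e] absorbs the error of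
   [set_jump_le], taken with [e / (K + 1)] so that multiplying by [K] stays below [e]. *)
pose H x := N x + (lam + e) * g x.
have -> : N v - N u + (lam + e) * (g v - g u) = H v - H u by rewrite /H; ring.
apply: mdist_le_of_local => //.
- move=> x y /[!in_itv]/= /andP[ux xv] /andP[uy yv] xy.
  rewrite /H lerD//.
    by apply: N_le => //; [exact: le_trans ux|exact: le_trans vt].
  rewrite ler_wpM2l ?addr_ge0 ?(ltW e0)//.
  by apply: g_le => //; [exact: le_trans ux|exact: le_trans vb].
- move=> x ux xv; apply: (infinitesimal_left_cvg gleft Finf).
    exact: le_lt_trans ux.
  exact: le_trans vb.
move=> x ux xv.
have ax : a <= x by exact: le_trans ux.
have xb : x < b by exact: lt_le_trans vb.
have sx : s <= x by exact: le_trans ux.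
have eK : 0 < e / (K + 1) by rewrite divr_gt0// ltr_wpDl.
have [r xr [rb Fr]] := set_jump_le gnd ax xb Finf eK.
exists (Num.min r v); first by rewrite lt_min xr xv ge_min lexx orbT.
set y := Num.min r v.
have xy : x < y by rewrite lt_min xr xv.
have yv : y <= v by rewrite ge_min lexx orbT.
have yr : y <= r by rewrite ge_min lexx.
have jy := right_jump_le gnd ax xb xy (le_trans yv vb).
have j0 := right_jump_ge0 gnd ax xb.
have Ny := N_jump sx xy (le_trans yv vt).
have KJ := young_jump ax xb c0; rewrite -/K -/lam in KJ.
have KF : K * mdist (F x) (F y) <=
    K * set_jump F x + e * (g y - g x - right_jump g x).
  apply: (le_trans (ler_wpM2l K0 (Fr y xy yr))); rewrite mulrDr lerD2l.
  rewrite mulrA ler_wpM2r ?subr_ge0// mulrCA ler_piMr ?(ltW e0)//.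
  by rewrite ler_pdivrMr ?ltr_wpDl// mul1r lerDl.
have : lam * right_jump g x <= lam * (g y - g x) by rewrite ler_wpM2l.
have : 0 <= e * right_jump g x by rewrite mulr_ge0// ltW.
rewrite /H; move: KF KJ Ny; move: (K * mdist _ _) (K * set_jump _ _).
by move=> A B *; lra.
Qed.

Lemma riesz_term_le u v : s <= u -> u < v -> v <= t ->
  (riesz_term p g F u v <= (N v - N u)%:E)%E.
Proof.
move=> su uv vt; rewrite /riesz_term.
have au : a <= u by rewrite (le_trans as_).
have vb : v <= b by rewrite (le_trans vt).
have Nuv := N_le su (ltW uv) vt.
have [guv|guv] := eqVneq (g v) (g u).
  (* The infinite branch of [riesz_term] is excluded: where [g] is constant, [F] does not move. *)
  suff -> : F v = F u by rewrite eqxx lee_fin subr_ge0.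
  have [eta eta0 Feta] := Finf ltr01.
  have := Feta u v au (ltW uv) vb; rewrite guv subrr mulr0 => /(_ (ltW eta0)).
  move=> Fuv; apply/esym/mdist_positivity/eqP.
  by rewrite eq_le Fuv mdist_ge0.
have G0 : 0 < g v - g u.
  by rewrite subr_gt0 lt_neqAle eq_sym guv g_le// ltW.
rewrite lee_fin metric_sym.
set d := mdist (F u) (F v); set G := g v - g u.
have c0 : 0 <= d / G by rewrite divr_ge0 ?mdist_ge0// ltW.
apply/ler_addgt0Pr => e e0.
(* At this slope Young's inequality is an equality, so the terms [(p - 1) * c ^ p * G] cancel; the
   slack [e / G] integrates to [e]. *)
have := @mdist_le_slope (d / G) (e / G) u v c0 (divr_gt0 e0 G0) su (ltW uv) vt.
rewrite young_powR_eq ?mdist_ge0// -/G.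
rewrite [_ * G in leRHS]mulrDl [e / G * G]divfK ?gt_eqF//.
by lra.
Qed.

End upper_bound.

(** The slope [c = J / D] is optimal at [tau]. Young's inequality with this fixed [c] bounds the
    term over [[tau, r]] below by an affine expression, whose value at [(J, D)] is [m tau]. *)
Lemma riesz_term_approx tau x e : a <= tau -> tau < x -> x <= b -> 0 < e ->
  0 < right_jump g tau ->
  exists2 r, tau < r < x & ((m tau - e)%:E <= riesz_term p g F tau r)%E.
Proof.
move=> atau taux xb e0 j0.
have taub : tau < b by exact: lt_le_trans xb.
set J := set_jump F tau; set D := right_jump g tau in j0 *.
pose c := J / D.
have J0 : 0 <= J := mdist_ge0 _ _.
have c0 : 0 <= c by rewrite divr_ge0// ltW.
pose K := p * c `^ (p - 1); pose lam := (p - 1) * c `^ p.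
have K0 : 0 <= K by rewrite mulr_ge0 ?powR_ge0// ltW.
have lam0 : 0 <= lam by rewrite mulr_ge0 ?powR_ge0// subr_ge0 ltW.
have KE : K * J = m tau + lam * D by exact: young_powR_eq.
(* An error [d] in both [J] and [D] costs [K * d + lam * d], which this choice keeps below [e]. *)
pose d := e / (K + lam + 1).
have KL0 : 0 < K + lam + 1 by rewrite ltr_wpDl// addr_ge0.
have d0 : 0 < d by rewrite divr_gt0.
near tau^'+ => r.
have taur : tau < r by near: r; exact: nbhs_right_gt.
have rx : r < x by near: r; exact: nbhs_right_lt.
exists r; first by rewrite taur.
have rb : r <= b by rewrite (le_trans (ltW rx)).
have Dr : D <= g r - g tau := right_jump_le gnd atau taub taur rb.
have gr : g r - g tau <= D + d.
  by near: r; exact: (near_right_jump gnd atau taub).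
have Fr : mdist (lim (F r @[r --> tau^'+])) (F r) <= d.
  by near: r; exact: (near_set_jump gnd atau taub Finf).
have G0 : 0 < g r - g tau by lra.
rewrite /riesz_term ifF; last first.
  by apply/negbTE; rewrite -subr_eq0 gt_eqF.
rewrite lee_fin.
have := young_powR p1 c0 (mdist_ge0 (F r) (F tau)) G0.
rewrite -/K -/lam.
have JF : J <= d + mdist (F r) (F tau).
  apply: le_trans (metric_triangle _ (F r) _) _; exact: lerD.
have := ler_wpM2l K0 JF; rewrite mulrDr KE.
have := ler_wpM2l lam0 gr; rewrite mulrDr.
have : d * K + d * lam <= e.
  have : d * (K + lam + 1) = e by rewrite divfK// gt_eqF.
  by rewrite !mulrDr; lra.
by lra.
Unshelve. all: by end_near. Qed.

Lemma riesz_term_ge0 u v : (0 <= riesz_term p g F u v)%E.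
Proof.
rewrite /riesz_term; case: ifP => _; first by case: ifP.
by rewrite lee_fin divr_ge0 ?powR_ge0.
Qed.

(** Any partition of [[s, tau]] is extended by [r] and [x]: the term over [[tau, r]] recovers
    [m tau] up to [e], and the one over [[r, x]] is nonnegative. *)
Lemma riesz_variation_jump s tau x : a <= s -> s <= tau -> tau < x -> x <= b ->
  0 < right_jump g tau ->
  (riesz_variation p g F s tau + (m tau)%:E <= riesz_variation p g F s x)%E.
Proof.
move=> as_ stau taux xb j0; rewrite -leeBrDr//.
apply: ge_ereal_sup => _ [P sP <-]; rewrite leeBrDr//.
apply/lee_addgt0Pr => e e0.
have [|r /andP[taur rx] mr] := riesz_term_approx _ taux xb e0 j0.
  exact: le_trans stau.
have rP : itv_partition tau x [:: r; x].
  by rewrite /itv_partition/= taur rx.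
have := itv_partition_cat sP rP; set Q := P ++ _ => sQ.
have : (riesz_sum p g F s Q <= riesz_variation p g F s x)%E.
  by apply: ereal_sup_ubound; exists Q.
rewrite /Q riesz_sum_cat (eqP sP.2) !riesz_sum_cons riesz_sum_nil adde0.
move=> /(leeD (lexx e%:E)); rewrite [leRHS]addeC; apply: le_trans.
rewrite addeCA leeD2l//.
have -> : (m tau)%:E = (e%:E + (m tau - e)%:E)%E by rewrite -EFinD subrKC.
by rewrite leeD2l// (le_trans mr)// leeDl// riesz_term_ge0.
Qed.

(** The largest jump [y] is peeled off first; the others lie in [[s, y)], where the induction
    hypothesis applies. *)
Lemma sum_jump_le_riesz_variation s (l : seq R) x :
  a <= s -> s <= x -> x <= b ->
  pairwise <%R l ->
  (forall tau, tau \in l -> s <= tau < x /\ 0 < right_jump g tau) ->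
  (\sum_(tau <- l) (m tau)%:E <= riesz_variation p g F s x)%E.
Proof.
move=> as_; elim/last_ind: l x => [|l y ih] x sx xb.
  (* The case [x = s] arises when the last jump peeled off sits at [s]; only the empty partition is
     then available. *)
  move=> _ _; rewrite big_nil; have [->|xs] := eqVneq x s.
    apply: ereal_sup_ubound; exists [::]; last by rewrite riesz_sum_nil.
    by rewrite /itv_partition/=.
  apply: ereal_sup_ge; exists (riesz_sum p g F s [:: x]).
    by exists [:: x] => //; apply: itv_partition1; rewrite lt_neqAle eq_sym xs.
  by rewrite riesz_sum_cons riesz_sum_nil adde0 riesz_term_ge0.
rewrite pairwise_rcons => /andP[/allP ly lP] lx.
have [/andP[sy yx] j0] : s <= y < x /\ 0 < right_jump g y.
  by apply: lx; rewrite mem_rcons inE eqxx.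
rewrite big_rcons/=; apply: le_trans (riesz_variation_jump as_ sy yx xb j0).
rewrite leeD2r//; apply: ih => //; first by rewrite (le_trans (ltW yx)).
move=> tau taul; have [|/andP[stau _] jtau] := lx tau.
  by rewrite mem_rcons inE taul orbT.
by rewrite stau ly.
Qed.

Lemma esum_jump_le_riesz_variation s t : a <= s -> s <= t -> t <= b ->
  (\esum_(tau in [set tau | s <= tau < t /\ 0 < right_jump g tau]%R) (m tau)%:E
    <= riesz_variation p g F s t)%E.
Proof.
move=> as_ st tb; apply: ge_ereal_sup => _ [A [finA AD] <-].
rewrite fsbig_finite//=.
set l := finmap.enum_fset _.
(* The finite set of jumps is listed in increasing order. *)
rewrite -(perm_big _ (permEl (perm_sort <=%R l)))/=.
apply: sum_jump_le_riesz_variation => //.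
  rewrite -sorted_pairwise; last exact: lt_trans.
  by rewrite sort_lt_sorted finmap.fset_uniq.
by move=> tau; rewrite mem_sort (in_fset_set finA) inE => /AD.
Qed.

Lemma riesz_variationE s t : a <= s -> s <= t -> t <= b ->
  riesz_variation p g F s t =
  \esum_(tau in [set tau | s <= tau < t /\ 0 < right_jump g tau]) (m tau)%:E.
Proof.
move=> as_ st tb; apply/eqP; rewrite eq_le esum_jump_le_riesz_variation// andbT.
pose D x := [set tau | s <= tau < x /\ 0 < right_jump g tau].
pose E x := (\esum_(tau in D x) (m tau)%:E)%E.
rewrite -/(E t).
have Em x r : s <= x -> x < r -> r <= t -> (E x + (m x)%:E <= E r)%E.
  move=> sx xr rt.
  rewrite [leRHS](esumID [set tau | tau < x]); last first.
    by move=> *; rewrite lee_fin.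
  have -> : D r `&` [set tau | tau < x] = D x.
    apply/seteqP; split => tau.
      by case=> -[/andP[stau _] ?] /= taux; rewrite /D/= stau taux.
    case=> /andP[stau taux] ?; split => //; split => //.
    by rewrite stau (lt_trans taux).
  rewrite leeD2l//.
  (* If [g] jumps at [x], the singleton [[set x]] contributes [m x] to the mass in [[x, r)];
     otherwise [m x] vanishes. *)
  have [j0|j0] := ltP 0 (right_jump g x).
    apply: esum_ge; exists [set x]; last by rewrite fsbig_set1.
    by split => // _ ->; rewrite /D/= sx xr ltxx.
  have ax := le_trans as_ sx.
  have xb : x < b by rewrite (lt_le_trans xr)// (le_trans rt).
  rewrite m_jump0//; first by apply: esum_ge0 => *; rewrite lee_fin.
  by apply/eqP; rewrite eq_le j0 (right_jump_ge0 gnd ax xb).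
(* An infinite jump sum makes the upper bound trivial; a finite one allows the real-valued
   [N := fine \o E]. *)
have [Et|] := ltP (E t) +oo%E; last by rewrite leye_eq => /eqP ->; exact: leey.
have E0 x : (0 <= E x)%E by apply: esum_ge0 => *; rewrite lee_fin.
have Efin x : s <= x -> x <= t -> E x \is a fin_num.
  move=> sx; rewrite le_eqVlt => /predU1P[->|xt]; rewrite ge0_fin_numE//.
  apply: le_lt_trans Et; apply: le_trans (Em _ _ sx xt (lexx t)).
  by rewrite leeDl// lee_fin.
apply: ge_ereal_sup => _ [P sP <-].
apply: (@le_trans _ _ (fine (E t) - fine (E s))%:E); last first.
  by rewrite EFinB !fineK ?Efin// leeBlDr ?Efin// leeDl.
apply: (riesz_sum_le_telescope (N := fine \o E) _ sP) => u v su uv vt /=.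
apply: (riesz_term_le (N := fine \o E) as_ tb _ su uv vt) => x r sx xr rt /=.
have rs := le_trans sx (ltW xr); have xt := le_trans (ltW xr) rt.
by rewrite -lee_fin EFinD !fineK ?Efin// Em.
Qed.

End identity.

Unset Implicit Arguments.

Theorem theorem9p7 (R : realType) (X : completeMetricType R) (a b : R)
    (g : R -> R) (F : R -> hyperspace X) (alpha p : R) :
  a <= b ->
  (forall t, a < t -> t <= b -> g r @[r --> t^'-] --> g t) ->
  {in `[a, b] &, nondecreasing_fun g} ->
  1 < alpha ->
  holder_wrt g F a b alpha ->
  1 < p ->
  forall s t, a <= s -> s < t -> t <= b ->
  riesz_variation p g F s t =
  \esum_(tau in [set tau | s <= tau < t /\ 0 < right_jump g tau])
     ((set_jump F tau) `^ p / (right_jump g tau) `^ (p - 1))%:E.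
Proof.
move=> _ gleft gnd alpha1 gF p1 s t as_ st tb.
apply: (riesz_variationE gleft gnd _ p1 as_ (ltW st) tb).
exact: holder_infinitesimal gF.
Qed.
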